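(* Let $sc$ be the Split Cycle VCCR (over linear profiles). Then: (i) $sc$ satisfies Anonymity, Neutrality, Availability, Homogeneity, Monotonicity, Neutral Reversal, Coherent IIA, Coherent Defeat, and Positive Involvement in Defeat; (ii) if $f$ is any VCCR satisfying Anonymity, Neutrality, Availability, Upward Homogeneity, Monotonicity for two-candidate profiles, Neutral Reversal, Coherent IIA, Coherent Defeat, and Positive Involvement in Defeat, then $f=sc$, i.e. $f(\mathbf P)=sc(\mathbf P)$ for every profile $\mathbf P$. (Since Homogeneity implies Upward Homogeneity and Monotonicity implies Monotonicity for two-candidate profiles, $sc$ is the unique VCCR satisfying these axioms under either reading.)
   Context: Fix infinite sets $\mathcal V$ (voters) and $\mathcal X$ (candidates). For a finite set $X$, $\mathcal L(X)$ is the set of strict linear orders on $X$. A (linear) profile is a function $\mathbf P:V\to\mathcal L(X)$ for some nonempty finite $V\subset\mathcal V$ and nonempty finite $X\subset\mathcal X$; write $V(\mathbf P)=V$, $X(\mathbf P)=X$. Voter $i$ ranks $x$ above $y$ if $(x,y)\in\mathbf P(i)$. For nonempty $Y\subseteq X(\mathbf P)$, $\mathbf P_{|Y}$ is the profile with the same voters in which each ballot is restricted to $Y$. $\mathrm{Margin}_{\mathbf P}(x,y)$ is the number of voters ranking $x$ above $y$ minus the number ranking $y$ above $x$; $x$ is majority preferred to $y$ if this is $>0$. The margin graph $\mathcal M(\mathbf P)$ has vertex set $X(\mathbf P)$ and an edge $x\to y$ of weight $\mathrm{Margin}_{\mathbf P}(x,y)$ whenever this margin is positive. A majority path from $x_1$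 to $x_n$ is a sequence $(x_1,\dots,x_n)$ with $\mathrm{Margin}_{\mathbf P}(x_i,x_{i+1})>0$ for all $i<n$; its strength is $\min_i \mathrm{Margin}_{\mathbf P}(x_i,x_{i+1})$; it is a majority cycle if $x_n=x_1$. A VCCR is a function $f$ assigning to every profile $\mathbf P$ an asymmetric binary relation $f(\mathbf P)$ on $X(\mathbf P)$; ''$x$ defeats $y$ in $\mathbf P$'' means $(x,y)\in f(\mathbf P)$. The Split Cycle VCCR $sc$: $(x,y)\in sc(\mathbf P)$ iff $\mathrm{Margin}_{\mathbf P}(x,y)>0$ and $\mathrm{Margin}_{\mathbf P}(x,y)$ is strictly greater than the strength of every majority path from $y$ to $x$. Axioms for a VCCR $f$: Anonymity: if $V(\mathbf P)=V(\mathbf P')$ and there is a bijection $\pi$ of $V(\mathbf P)$ with $\mathbf P'(i)=\mathbf P(\pi(i))$ for all $i$, then $f(\mathbf P)=f(\mathbf P')$. Neutrality: if $V(\mathbf P)=V(\mathbf P')$, $X(\mathbf P)=X(\mathbf P')$ and there is a bijection $\pi$ of $X(\mathbf P)$ such that for all $i$ and $x,y$, $(x,y)\in\mathbf P(i)$ iff $(\pi(x),\pi(y))\in\mathbf P'(i)$, then $(x,y)\in f(\mathbf P)$ iff $(\pi(x),\pi(y))\in f(\mathbf P')$. Availability: for every $\mathbf P$ some $x\in X(\mathbf P)$ is defeated by no candidate. Homogeneity (resp. Upward Homogeneity): $f(\mathbf P)=f(2\mathbf P)$ (resp. $f(\mathbf P)\subseteq f(2\mathbf P)$), where $2\mathbf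 P$ replaces each voter by two copies. Monotonicity (resp. for two-candidate profiles): for every profile (resp. every profile with two candidates) $\mathbf P$, if $\mathbf P'$ is obtained by moving $x$ up one place in one voter's ballot (swapping $x$ with the candidate immediately above it, all other relative orders unchanged), then $(x,y)\in f(\mathbf P)$ implies $(x,y)\in f(\mathbf P')$. Neutral Reversal: if $\mathbf P'$ is obtained from $\mathbf P$ by adding two voters whose ballots are converses of each other, then $f(\mathbf P)=f(\mathbf P')$. Coherent IIA: write $\mathbf P\rightsquigarrow_{x,y}\mathbf P'$ if $\mathbf P_{|\{x,y\}}=\mathbf P'_{|\{x,y\}}$ and $\mathcal M(\mathbf P')$ can be obtained from $\mathcal M(\mathbf P)$ by deleting zero or more candidates other than $x,y$ and deleting or reducing the weights of zero or more edges not connecting $x$ and $y$. Coherent IIA: if $(x,y)\in f(\mathbf P)$ and $\mathbf P\rightsquigarrow_{x,y}\mathbf P'$ then $(x,y)\in f(\mathbf P')$. Coherent Defeat: if $\mathrm{Margin}_{\mathbf P}(x,y)>0$ and there is no majority path from $y$ to $x$ in $\mathbf P$, then $(x,y)\in f(\mathbf P)$. Positive Involvement in Defeat: if $(x,y)\notin f(\mathbf P)$ and $\mathbf P'$ is obtained from $\mathbf P$ by adding one new voter who ranks $y$ above $x$, then $(x,y)\notin f(\mathbf P')$. *)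

(* Defs.v *)
From HB Require Import structures.
From mathcomp Require Import all_boot all_order all_algebra.
From mathcomp Require Import finmap.
Set Implicit Arguments. Unset Strict Implicit. Unset Printing Implicit Defensive.
Import Order.TTheory GRing.Theory Num.Theory.
Local Open Scope fset_scope.
Local Open Scope fmap_scope.

Definition infinite_type (T : choiceType) : Prop :=
  forall s : seq T, exists x : T, x \notin s.

Section Profiles.
Variables (Vt Xt : choiceType).

(* A strict linear order on a finite set X is represented by the list of the
   elements of X from top to bottom (a duplicate-free enumeration of X). *)
Definition wf_profile (X : {fset Xt}) (B : {fmap Vt -> seq Xt}) : bool :=
  [&& X != fset0, domf B != fset0 &
      all (fun i => if B.[? i] is Some b then uniq b && perm_eq b (enum_fset X)
                    else false) (enum_fset (domf B))].

Record profile := Profile {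
  pcands : {fset Xt};
  pballots : {fmap Vt -> seq Xt};    (* voter i |-> ballot of i, top first *)
  pwf : wf_profile pcands pballots }.

Definition voters (P : profile) : {fset Vt} := domf (pballots P).

(* the ballot of voter i (meaningful for i \in voters P) *)
Definition ballot (P : profile) (i : Vt) : seq Xt :=
  odflt [::] (pballots P).[? i].

Definition above (P : profile) (i : Vt) (a b : Xt) : bool :=
  [&& a \in pcands P, b \in pcands P &
      index a (ballot P i) < index b (ballot P i)]%N.

Definition margin (P : profile) (a b : Xt) : int :=
  (count (fun i => above P i a b) (enum_fset (voters P)))%:Z -
  (count (fun i => above P i b a) (enum_fset (voters P)))%:Z.

Definition majority_path (P : profile) (a : Xt) (s : seq Xt) : bool :=
  (s != [::]) && path (fun u v => 0 < margin P u v)%R a s.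

Fixpoint minseq (m : int) (s : seq int) : int :=
  if s is m' :: s' then Num.min m (minseq m' s') else m.

Definition strength (P : profile) (a : Xt) (s : seq Xt) : int :=
  if pairmap (margin P) a s is m :: ms then minseq m ms else 0.

Definition VCCR_rel := profile -> Xt -> Xt -> Prop.

Definition is_VCCR (f : VCCR_rel) : Prop :=
  forall P x y, f P x y -> [/\ x \in pcands P, y \in pcands P & ~ f P y x].

Definition sc : VCCR_rel := fun P x y =>
  (0 < margin P x y)%R /\
  forall s : seq Xt, majority_path P y s -> last y s = x ->
    (strength P y s < margin P x y)%R.

Definition anonymity (f : VCCR_rel) : Prop :=
  forall (P P' : profile) (pi : Vt -> Vt),
    voters P = voters P' ->
    {in voters P, forall i, pi i \in voters P} ->
    {in voters P &, injective pi} ->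
    {in voters P, forall j, exists2 i, i \in voters P & pi i = j} ->
    {in voters P, forall i, ballot P' i = ballot P (pi i)} ->
    forall x y, f P x y <-> f P' x y.

Definition neutrality (f : VCCR_rel) : Prop :=
  forall (P P' : profile) (pi : Xt -> Xt),
    voters P = voters P' -> pcands P = pcands P' ->
    {in pcands P, forall x, pi x \in pcands P} ->
    {in pcands P &, injective pi} ->
    {in pcands P, forall y, exists2 x, x \in pcands P & pi x = y} ->
    {in voters P, forall i, {in pcands P &, forall x y,
        above P i x y = above P' i (pi x) (pi y)}} ->
    {in pcands P &, forall x y, f P x y <-> f P' (pi x) (pi y)}.

Definition availability (f : VCCR_rel) : Prop :=
  forall P : profile, exists2 x, x \in pcands P &
    forall y, y \in pcands P -> ~ f P y x.

Definition doubling (P P' : profile) : Prop :=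
  pcands P' = pcands P /\
  exists phi : Vt -> Vt,
    [/\ {in voters P', forall j, phi j \in voters P},
        {in voters P, forall i,
           count (fun j => phi j == i) (enum_fset (voters P')) = 2%N} &
        {in voters P', forall j, ballot P' j = ballot P (phi j)}].

Definition homogeneity (f : VCCR_rel) : Prop :=
  forall P P', doubling P P' -> forall x y, f P x y <-> f P' x y.

Definition upward_homogeneity (f : VCCR_rel) : Prop :=
  forall P P', doubling P P' -> forall x y, f P x y -> f P' x y.

Definition move_up (P P' : profile) (x : Xt) : Prop :=
  voters P' = voters P /\ pcands P' = pcands P /\
  exists2 i, i \in voters P &
    (exists s1 s2 z, ballot P i = s1 ++ z :: x :: s2 /\
                     ballot P' i = s1 ++ x :: z :: s2) /\
    {in voters P, forall j, j != i -> ballot P' j = ballot P j}.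

Definition monotonicity (f : VCCR_rel) : Prop :=
  forall P P' x, move_up P P' x -> forall y, f P x y -> f P' x y.

Definition monotonicity_two (f : VCCR_rel) : Prop :=
  forall P P' x, #|` pcands P| = 2%N ->
    move_up P P' x -> forall y, f P x y -> f P' x y.

Definition add_reversal_pair (P P' : profile) : Prop :=
  pcands P' = pcands P /\
  exists a b, [/\ a != b, a \notin voters P /\ b \notin voters P,
     (voters P' = a |` (b |` voters P))%fset,
     ballot P' b = rev (ballot P' a) &
     {in voters P, forall j, ballot P' j = ballot P j}].

Definition neutral_reversal (f : VCCR_rel) : Prop :=
  forall P P', add_reversal_pair P P' -> forall x y, f P x y <-> f P' x y.

Definition coh_step (P P' : profile) (x y : Xt) : Prop :=
  [/\ voters P' = voters P,
      x \in pcands P' /\ y \in pcands P',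
      pcands P' `<=` pcands P,
      {in voters P, forall i, above P i x y = above P' i x y /\
                              above P i y x = above P' i y x} &
      {in pcands P' &, forall a b, ~ ((a == x) && (b == y) || (a == y) && (b == x)) ->
         (0 < margin P' a b)%R -> (margin P' a b <= margin P a b)%R}].

Definition coherent_IIA (f : VCCR_rel) : Prop :=
  forall P P' x y, f P x y -> coh_step P P' x y -> f P' x y.

Definition coherent_defeat (f : VCCR_rel) : Prop :=
  forall P x y, (0 < margin P x y)%R ->
    ~ (exists s, majority_path P y s /\ last y s = x) -> f P x y.

Definition add_voter (P P' : profile) (i : Vt) : Prop :=
  [/\ pcands P' = pcands P, i \notin voters P,
      (voters P' = i |` voters P)%fset &
      {in voters P, forall j, ballot P' j = ballot P j}].

Definition positive_involvement_in_defeat (f : VCCR_rel) : Prop :=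
  forall P P' i x y, ~ f P x y -> add_voter P P' i -> above P' i y x ->
    ~ f P' x y.

End Profiles.

(* Main.v *)
(* Split Cycle is governed by one criterion: x defeats y iff the margin m of x
   over y is positive and no path from y to x has all its edges >= m.  All the
   axioms but availability follow by comparing margins.

   Let f satisfy the axioms.  sc is contained in f: let S be the set of candidates
   reachable from y through edges >= m.  Adding m - 1 voters who rank the outside
   of S above S, except that y is above x, destroys every majority path from y to
   x, so coherent defeat applies, and positive involvement carries the defeat back.

   f is contained in sc: a defeat has positive margin by May's argument on {x, y}.
   If x defeats y although some path from y to x has all its edges >= m, shorten
   it to a cycle through x and y, double the profile, and delete the other
   candidates.  Relabelling by rotation gives, for each edge z -> z' of the cycle,
   a profile in which z defeats z' with margin 2m, all cycle edges being >= 2m.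
   Each of these defeats transfers by coherent IIA to one McGarvey profile whose
   margins are 2m along the cycle and 0 elsewhere, so that every candidate is
   defeated there, against availability. *)
Require Import Defs.
From mathcomp Require Import all_boot all_order all_algebra.
From mathcomp Require Import finmap.
From mathcomp Require Import boolp zify.

Set Implicit Arguments.
Unset Strict Implicit.
Unset Printing Implicit Defensive.
Import Order.TTheory GRing.Theory Num.Theory.
Local Open Scope fset_scope.
Local Open Scope ring_scope.

(** * Comparisons within a single ballot *)

Section Ballots.
Variable T : eqType.
Implicit Types (b s : seq T) (a c u v : T).

(** The contribution of one ballot to a margin, so that margins become sums over voters; it vanishes
    for [a = c]. *)
Definition bmargin b a c : int :=
  (index a b < index c b)%N%:Z - (index c b < index a b)%N%:Z.

Lemma bmarginC b a c : bmargin b c a = - bmargin b a c.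
Proof. by rewrite opprB. Qed.

Lemma bmargin_ge b a c : -1 <= bmargin b a c.
Proof. by rewrite /bmargin; case: (_ < _)%N; case: (_ < _)%N. Qed.

Lemma bmargin1 b a c : (index a b < index c b)%N -> bmargin b a c = 1.
Proof. by move=> ac; rewrite /bmargin ac ltnNge ltnW. Qed.

Lemma index_rev b a : uniq b -> a \in b ->
  index a (rev b) = (size b - (index a b).+1)%N.
Proof.
move=> Ub ab; have ltab : (index a b < size b)%N by rewrite index_mem.
have lt' : (size b - (index a b).+1 < size b)%N by lia.
rewrite -{1}(nth_index a ab).
have -> : nth a b (index a b) = nth a (rev b) (size b - (index a b).+1).
  by rewrite nth_rev //; congr nth; lia.
by rewrite index_uniq ?size_rev ?rev_uniq.
Qed.

Lemma bmargin_rev b a c : uniq b -> a \in b -> c \in b ->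
  bmargin (rev b) a c = - bmargin b a c.
Proof.
move=> Ub ab cb; rewrite /bmargin !index_rev //.
move: ab cb; rewrite -!index_mem => ab cb.
have lt_rev m n : (m < size b)%N -> (n < size b)%N ->
    (size b - m.+1 < size b - n.+1)%N = (n < m)%N by lia.
by rewrite !lt_rev // opprB.
Qed.

Lemma index_filter_lt (p : pred T) b a c : a \in b -> c \in b -> p a -> p c ->
  (index a (filter p b) < index c (filter p b))%N = (index a b < index c b)%N.
Proof.
move=> + + pa pc; elim: b => //= h b IHb; rewrite !inE ![_ == h]eq_sym.
have [->|ha] /= := eqVneq h a; first by rewrite pa /= eqxx; case: eqP.
have [->|hc] /= := eqVneq h c; first by rewrite pc /= eqxx; case: eqP.
by move=> ab cb; case: ifP => _ /=; rewrite ?(negPf ha) ?(negPf hc) ?ltnS IHb.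
Qed.

(** Only the comparison of [u] with [v] changes, and the swap is unfavourable to [u] alone. *)
Lemma bmargin_swap s1 s2 u v a c : u != v -> a != u ->
  bmargin (s1 ++ u :: v :: s2) a c <= bmargin (s1 ++ v :: u :: s2) a c.
Proof.
move=> uv au; rewrite /bmargin !index_cat.
case: ifP => as1; case: ifP => cs1;
  rewrite ?lexx //= 1?[u == a]eq_sym ?(negPf au) /=.
- by move: as1; rewrite -index_mem; do ?[case: ltngtP => ? //]; lia.
- by move: cs1; rewrite -index_mem; do ?[case: ltngtP => ? //]; lia.
have [vc|vc] := eqVneq v c.
  rewrite -vc (negPf uv); case: (eqVneq v a) => _;
  by do ?[case: ltngtP => ? //]; lia.
by case: (eqVneq v a) => _; case: (eqVneq u c) => _; do ?[case: ltngtP => ? //]; lia.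
Qed.

(** Serves McGarvey's construction, whose second ballot is a reversal and so enters margins with a
    minus sign. *)
Lemma bmargin_top2 u v b a c : u != v ->
  bmargin (u :: v :: b) a c - bmargin (v :: u :: b) a c =
  (((u == a) && (v == c))%:Z - ((u == c) && (v == a))%:Z) *+ 2.
Proof.
move=> uv; rewrite /bmargin /=.
have [ua|ua] := eqVneq u a; have [va|va] := eqVneq v a;
have [uc|uc] := eqVneq u c; have [vc|vc] := eqVneq v c;
  subst; rewrite ?eqxx ?ltnn ?subrr // in uv *.
Qed.

End Ballots.

(** * Profiles and their margins *)

Section ProfileTheory.
Variables Vt Xt : choiceType.
Implicit Types (P Q : profile Vt Xt) (i j : Vt) (a b c x y : Xt).
Implicit Types (X : {fset Xt}) (V : {fset Vt}).

Lemma ballot_perm P i : i \in voters P -> perm_eq (ballot P i) (pcands P).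
Proof.
case: P => X B wfB /= iB; have /and3P[_ _ /allP/(_ i iB)] := wfB.
by rewrite /ballot /=; case: fnd => //= s /andP[].
Qed.

Lemma ballot_uniq P i : i \in voters P -> uniq (ballot P i).
Proof. by move=> /ballot_perm/perm_uniq ->; exact: fset_uniq. Qed.

Lemma mem_ballot P i : i \in voters P -> ballot P i =i pcands P.
Proof. by move=> /ballot_perm/perm_mem. Qed.

Lemma pcands_neq0 P : pcands P != fset0.
Proof. by case: P => X B wfB; have /and3P[] := wfB. Qed.

Lemma voters_neq0 P : voters P != fset0.
Proof. by case: P => X B wfB; have /and3P[] := wfB. Qed.

Lemma profile_exists X V (beta : Vt -> seq Xt) :
    X != fset0 -> V != fset0 -> {in V, forall i, perm_eq (beta i) X} ->
  exists P, [/\ pcands P = X, voters P = V &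
                {in V, forall i, ballot P i = beta i}].
Proof.
move=> X0 V0 betaX; pose B := ([fmap i : V => beta (val i)])%fmap.
have BE i : i \in V -> (B.[? i])%fmap = Some (beta i).
  by move=> iV; rewrite (in_fnd iV) ffunE.
have wfB : wf_profile X B.
  apply/and3P; split=> //; apply/allP => i iV; rewrite BE // betaX // andbT.
  by rewrite (perm_uniq (betaX i iV)) fset_uniq.
by exists (Profile wfB); split=> // i iV; rewrite /ballot /= BE.
Qed.

Lemma aboveE P i a c : a \in pcands P -> c \in pcands P ->
  above P i a c = (index a (ballot P i) < index c (ballot P i))%N.
Proof. by rewrite /above => -> ->. Qed.

Lemma count_sumz (T : Type) (p : pred T) (s : seq T) :
  (count p s)%:Z = \sum_(i <- s) (p i)%:Z.
Proof. by elim: s => [|i s IHs]; rewrite ?big_nil // big_cons -IHs. Qed.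

Lemma marginE P a c : a \in pcands P -> c \in pcands P ->
  margin P a c = \sum_(i <- voters P) bmargin (ballot P i) a c.
Proof.
move=> aP cP; rewrite /margin !count_sumz -sumrB; apply: eq_bigr => i _.
by rewrite !aboveE.
Qed.

Lemma marginC P a c : margin P c a = - margin P a c.
Proof. by rewrite opprB. Qed.

Lemma margin_notin P a c : ~~ ((a \in pcands P) && (c \in pcands P)) ->
  margin P a c = 0.
Proof.
move=> acP; have out i : above P i a c = false /\ above P i c a = false.
  by rewrite /above; move: acP; do 2!case: (_ \in pcands P).
rewrite /margin (eq_count (fun i => (out i).1)).
by rewrite (eq_count (fun i => (out i).2)) subrr.
Qed.

Lemma margin_cands P a c : 0 < margin P a c ->
  (a \in pcands P) && (c \in pcands P).
Proof. by apply: contraTT => /margin_notin ->. Qed.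

Lemma margin_eq P Q : pcands P = pcands Q ->
    {in pcands P &, forall a c, margin P a c = margin Q a c} ->
  forall a c, margin P a c = margin Q a c.
Proof.
move=> PQ eqm a c.
have [/andP[aP cP]|acP] := boolP ((a \in pcands P) && (c \in pcands P)).
  exact: eqm.
by rewrite !margin_notin // -PQ.
Qed.

Lemma margin_add_voter P Q i : pcands Q = pcands P -> i \notin voters P ->
    voters Q = i |` voters P -> {in voters P, forall j, ballot Q j = ballot P j} ->
  {in pcands P &, forall a c,
     margin Q a c = margin P a c + bmargin (ballot Q i) a c}.
Proof.
move=> QP iP VQ eqb a c aP cP; rewrite !marginE ?QP // VQ big_fsetU1 //= addrC.
by congr (_ + _); apply: eq_big_seq => j jP; rewrite eqb.
Qed.

Lemma add_voter_exists P i s : i \notin voters P -> perm_eq s (pcands P) ->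
  exists Q, [/\ add_voter P Q i, ballot Q i = s &
    {in pcands P &, forall a c, margin Q a c = margin P a c + bmargin s a c}].
Proof.
move=> iP sP; pose beta j := if j == i then s else ballot P j.
have [||j|Q [QP VQ bQ]] := @profile_exists (pcands P) (i |` voters P) beta.
- exact: pcands_neq0.
- by apply/fset0Pn; exists i; rewrite fset1U1.
- by rewrite /beta !inE; case: eqP => //= _; exact: ballot_perm.
have bi : ballot Q i = s by rewrite bQ ?fset1U1 // /beta eqxx.
have addQ : add_voter P Q i.
  split=> // j jP; rewrite bQ ?inE ?jP ?orbT // /beta.
  by case: eqP jP iP => // -> ->.
by exists Q; split=> // a c aP cP; rewrite (@margin_add_voter P Q i) ?bi //; case: addQ.
Qed.

End ProfileTheory.

(** * Split Cycle satisfies the axioms *)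

Lemma path_until (T : eqType) (e : rel T) x a (s : seq T) :
    path e a s -> last a s = x ->
  exists2 s', path (fun u v => (u != x) && e u v) a s' & last a s' = x.
Proof.
elim: s a => [|b s IHs] a /=; first by exists [::].
case/andP=> eab ebs lastx; have [ax|ax] := eqVneq a x; first by exists [::].
have [s' es' last'] := IHs b ebs lastx.
by exists (b :: s'); rewrite //= ax eab.
Qed.

Section SplitCycle.
Variables Vt Xt : choiceType.
Implicit Types (P Q : profile Vt Xt) (x y : Xt).

(** Trades minima for paths in a thresholded graph. The empty path has default strength 0, hence [s
    != [::]]. *)
Lemma strength_ge P m a s : s != [::] ->
  (m <= strength P a s) = path (fun u v => m <= margin P u v) a s.
Proof.
case: s => // b s _ /=; rewrite /strength /=; move: (margin P a b) => k.
by elim: s b k => [|c s IHs] b k /=; rewrite ?andbT // le_min IHs.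
Qed.

Lemma sc_no_path P x y : sc P x y ->
  forall s, path (fun u v => margin P x y <= margin P u v) y s -> last y s <> x.
Proof.
(* The empty path would give [y = x], whose margin is 0. *)
move=> [m0 strong] [_ yx|z s path_s last_s].
  by move: m0; rewrite -yx /= /margin subrr ltxx.
have /strong/(_ last_s) : majority_path P y (z :: s).
  by apply: sub_path path_s => u v; apply: lt_le_trans.
by rewrite ltNge strength_ge ?path_s.
Qed.

(* Paths may be cut at their first visit to x, so edges leaving x are
   irrelevant. *)
Lemma no_path_sc P x y : 0 < margin P x y ->
    (forall s, path (fun u v => (u != x) && (margin P x y <= margin P u v)) y s ->
       last y s <> x) ->
  sc P x y.
Proof.
move=> m0 nopath; split=> // s /andP[s0 _] last_s; rewrite ltNge strength_ge //.
by apply/negP => /path_until/(_ last_s)[s' /nopath].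
Qed.

(** A path in [Q] that contradicts the defeat is mapped by [g] to one in [P]. This reduces most
    axioms to comparing margins; [g] differs from the identity only for neutrality. *)
Lemma sc_transfer P Q (g : Xt -> Xt) x y : sc P (g x) (g y) -> 0 < margin Q x y ->
    (forall a b, a != x -> margin Q x y <= margin Q a b ->
       margin P (g x) (g y) <= margin P (g a) (g b)) ->
  sc Q x y.
Proof.
move=> scP m0 le_m; apply: no_path_sc m0 _ => s path_s last_s.
apply: (sc_no_path scP (s := map g s)); last by rewrite last_map last_s.
by rewrite path_map; apply: sub_path path_s => u v /andP[]; apply: le_m.
Qed.

Lemma sc_margin P Q x y : (forall a b, margin P a b = margin Q a b) ->
  sc P x y <-> sc Q x y.
Proof.
move=> eqm; split=> sc1; (apply: (sc_transfer (g := id) sc1) => /= [|a b _];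
  [by case: sc1 => + _; rewrite eqm | by rewrite !eqm]).
Qed.

Lemma sc_VCCR : is_VCCR (@sc Vt Xt).
Proof.
move=> P x y [m0 _]; have /andP[xP yP] := margin_cands m0; split=> // -[m1 _].
by move: m1; rewrite marginC oppr_gt0 ltNge ltW.
Qed.

Lemma margin_anonymity P P' (pi : Vt -> Vt) :
    voters P = voters P' ->
    {in voters P, forall i, pi i \in voters P} ->
    {in voters P &, injective pi} ->
    {in voters P, forall j, exists2 i, i \in voters P & pi i = j} ->
    {in voters P, forall i, ballot P' i = ballot P (pi i)} ->
  forall a b, margin P a b = margin P' a b.
Proof.
move=> VP piV inj_pi sur_pi eqb a b.
(* Equality of the candidate sets is read off from the ballot of any one voter. *)
have XP : pcands P = pcands P'.
  have /fset0Pn[i iV] := voters_neq0 P; apply/fsetP => c.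
  by rewrite -(mem_ballot (piV i iV)) -eqb // mem_ballot -?VP.
have perm_pi : perm_eq (map pi (voters P)) (voters P).
  apply: uniq_perm => [||j]; rewrite ?map_inj_in_uniq ?fset_uniq //.
  apply/mapP/idP => [[i iV ->]|/sur_pi[i iV <-]]; first exact: piV.
  by exists i.
have count_pi c d : count (fun i => above P' i c d) (voters P') =
    count (fun i => above P i c d) (voters P).
  rewrite -(permP perm_pi) count_map -VP; apply: eq_in_count => i iV /=.
  by rewrite /above -XP eqb.
by rewrite /margin !count_pi.
Qed.

Lemma sc_anonymity : anonymity (@sc Vt Xt).
Proof.
move=> P P' pi VP piV inj_pi sur_pi eqb x y; apply: sc_margin.
exact: margin_anonymity eqb.
Qed.

Lemma sc_neutrality : neutrality (@sc Vt Xt).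
Proof.
move=> P P' pi VP XP piX inj_pi sur_pi eq_above x y xX yX.
have eqm : {in pcands P &, forall a b, margin P a b = margin P' (pi a) (pi b)}.
  move=> a b aX bX; rewrite /margin -VP.
  by congr (_%:Z - _%:Z); apply: eq_in_count => i iV; rewrite eq_above.
(* [pi] is a bijection of the candidates only, so an inverse on them is chosen pointwise. *)
have /choice[pi' pi'P] b : exists a, b \in pcands P -> a \in pcands P /\ pi a = b.
  have [bX|_] := boolP (b \in pcands P); last by exists b.
  by have [a aX <-] := sur_pi b bX; exists a.
have piK a : a \in pcands P -> pi' (pi a) = a.
  by move=> aX; have [pi'X] := pi'P _ (piX a aX); apply: inj_pi.
split=> sc1.
  have m1 : 0 < margin P' (pi x) (pi y) by rewrite -eqm //; case: sc1.
  apply: (@sc_transfer P P' pi'); rewrite ?m1 ?piK // => a b _ le_m.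
  have /margin_cands := lt_le_trans m1 le_m; rewrite -XP => /andP[aX bX].
  have [[a'X aE] [b'X bE]] := (pi'P a aX, pi'P b bX).
  by rewrite !eqm // aE bE.
have m1 : 0 < margin P x y by rewrite eqm //; case: sc1.
apply: (@sc_transfer P' P pi) => // a b _ le_m.
have /margin_cands/andP[aX bX] := lt_le_trans m1 le_m.
by rewrite -!eqm.
Qed.

Lemma margin_doubling P P' : doubling P P' ->
  {in pcands P &, forall a b, margin P' a b = margin P a b *+ 2}.
Proof.
move=> [XP [phi [phiV phi2 eqb]]] a b aX bX.
(* Each voter of [P] is hit exactly twice by [phi], so the sum over [P'] is two sums over [P]. *)
have perm_phi : perm_eq (map phi (voters P')) (voters P ++ voters P).
  apply/allP => i; rewrite /= count_cat count_map !count_uniq_mem ?fset_uniq //.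
  rewrite !mem_cat orbb => /orP[/mapP[j jV ->]|iV]; last by rewrite phi2 ?iV.
  by rewrite phi2 phiV.
rewrite !marginE ?XP //.
rewrite (eq_big_seq (fun j => bmargin (ballot P (phi j)) a b)); last first.
  by move=> j jV; rewrite eqb.
rewrite -(big_map phi predT (fun i => bmargin (ballot P i) a b)).
by rewrite (perm_big _ perm_phi) big_cat mulr2n.
Qed.

Lemma margin_reversal P P' : add_reversal_pair P P' ->
  forall a b, margin P a b = margin P' a b.
Proof.
move=> [XP [i [j [ij [iP jP] VP ij_rev eqb]]]].
apply: margin_eq => // a b aX bX; rewrite [RHS]marginE ?XP // VP.
have iV : i \in voters P' by rewrite VP !inE eqxx.
rewrite !big_fsetU1 //= ?inE ?(negPf ij) // marginE //.
rewrite ij_rev bmargin_rev ?ballot_uniq ?mem_ballot ?XP // addrA subrr add0r.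
by apply: eq_big_seq => k kP; rewrite eqb.
Qed.

Lemma sc_homogeneity : homogeneity (@sc Vt Xt).
Proof.
move=> P P' dP x y; have XP : pcands P' = pcands P by case: dP.
have mE a b : margin P' a b = margin P a b *+ 2.
  have [/andP[aX bX]|out] := boolP ((a \in pcands P) && (b \in pcands P)).
    exact: margin_doubling.
  by rewrite !margin_notin ?XP.
split=> sc1; (apply: (sc_transfer (g := id) sc1) => /= [|a b _];
  [by case: sc1 => + _; rewrite mE; lia | by rewrite !mE; lia]).
Qed.

(** Raising [x] can increase margins only on edges leaving [x], which [no_path_sc] ignores. *)
Lemma sc_monotonicity : monotonicity (@sc Vt Xt).
Proof.
move=> P P' x [VP [XP [i iV [[s1 [s2 [z [bP bP']]]] eqb]]]] y scP.
have m0 : 0 < margin P x y by case: scP.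
have le_m a b : a != x -> a \in pcands P -> b \in pcands P ->
    margin P' a b <= margin P a b.
  move=> ax aX bX; rewrite !marginE ?XP // VP !big_seq; apply: ler_sum => j jV.
  have [->|ji] := eqVneq j i; last by rewrite eqb.
  rewrite bP bP'; apply: bmargin_swap => //.
  have := ballot_uniq iV; rewrite bP cat_uniq /= inE => /and3P[_ _].
  by rewrite negb_or eq_sym => /andP[/andP[]].
have /andP[xX yX] := margin_cands m0.
have yx : y != x by apply: contraTneq m0 => ->; rewrite /margin subrr ltxx.
have le_xy : margin P x y <= margin P' x y.
  by rewrite marginC [leRHS]marginC lerN2 le_m.
apply: (sc_transfer (g := id) scP) => /= [|a b ax le_ab].
  exact: lt_le_trans le_xy.
have /margin_cands := lt_le_trans m0 (le_trans le_xy le_ab).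
rewrite XP => /andP[aX bX].
exact: le_trans le_xy (le_trans le_ab (le_m _ _ ax aX bX)).
Qed.

Lemma sc_neutral_reversal : neutral_reversal (@sc Vt Xt).
Proof. by move=> P P' /margin_reversal eqm x y; apply: sc_margin. Qed.

Lemma sc_coherent_IIA : coherent_IIA (@sc Vt Xt).
Proof.
move=> P P' x y scP [VP [xX yX] XP eq_xy le_m].
have m0 : 0 < margin P x y by case: scP.
have eqm : margin P' x y = margin P x y.
  rewrite /margin VP; congr (_%:Z - _%:Z); apply: eq_in_count => i iV.
    by case: (eq_xy i iV).
  by case: (eq_xy i iV).
apply: (sc_transfer (g := id) scP) => /= [|a b ax le_ab]; first by rewrite eqm.
have mab : 0 < margin P' a b by apply: lt_le_trans le_ab; rewrite eqm.
have /andP[aX bX] := margin_cands mab.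
rewrite -eqm; apply: le_trans le_ab _; apply: le_m => //.
(* The only exempt edge left runs from [y] to [x], and its margin is negative. *)
rewrite (negPf ax) /= => /andP[/eqP ay /eqP bx].
by move: mab; rewrite ay bx marginC eqm oppr_gt0 ltNge ltW.
Qed.

Lemma sc_coherent_defeat : coherent_defeat (@sc Vt Xt).
Proof.
by move=> P x y m0 nopath; split=> // s maj_s last_s; case: nopath; exists s.
Qed.

(** Removing the new voter raises the margin of [x] over [y] by exactly 1 and any other margin by at
    most 1. *)
Lemma sc_positive_involvement : positive_involvement_in_defeat (@sc Vt Xt).
Proof.
move=> P P' i x y Nsc [XP iP VP eqb] yx_i sc'; apply: Nsc.
have /and3P[yX xX _] := yx_i; rewrite XP in xX yX.
have mE := margin_add_voter XP iP VP eqb.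
have mxy : margin P x y = margin P' x y + 1.
  by rewrite mE // bmarginC bmargin1 ?subrK // -aboveE ?XP.
have m0 : 0 < margin P' x y by case: sc'.
apply: (sc_transfer (g := id) sc') => /= [|a b _].
  by rewrite mxy ltr_wpDr.
rewrite mxy => le_m; have /margin_cands/andP[aX bX] : 0 < margin P a b by lia.
by rewrite (mE a b) //; have := bmargin_ge (ballot P' i) a b; lia.
Qed.

(* The defeats of a periodic point of a choice of defeaters form a cycle, and
   its weakest edge is not a Split Cycle defeat. *)
Lemma sc_availability : availability (@sc Vt Xt).
Proof.
move=> P; apply: contrapT => undef.
have defeated (y : pcands P) : exists x : pcands P, sc P (val x) (val y).
  apply: contrapT => /forallNP Ndef; apply: undef.
  exists (val y) => [|x xX scxy]; first exact: valP.
  exact: (Ndef [` xX]).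
have [g scg] := fin_all_exists defeated.
pose n := #|{: pcands P}|.
pose periodic z := [exists k : 'I_n, iter k.+1 g z == z].
have [z0 pz0] : exists z, periodic z.
  have /fset0Pn[c cX] := pcands_neq0 P.
  (* The orbit of any candidate under [g] returns to its [i]-th point after [order - i] steps;
     periods are stored minus one. *)
  have /trajectP[i lti eqi] := looping_order g [` cX].
  exists (iter i g [` cX]); apply/existsP.
  have ltn : (order g [` cX] - i.+1 < n)%N.
    by have := max_card (fconnect g [` cX]); rewrite -/(order g [` cX]) -/n; lia.
  exists (Ordinal ltn); rewrite -iterD -eqi; apply/eqP.
  by congr (iter _ g); move=> /=; lia.
pose w z := margin P (val (g z)) (val z).
(* Among the periodic points, [z] has the weakest incoming defeat [g z -> z]. *)
case: (Order.TotalTheory.arg_minP w pz0) => z /existsP[k /eqP zk] min_z.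
have per_iter j : periodic (iter j g z).
  by apply/existsP; exists k; rewrite -iterD addnC iterD zk.
(* Walking down the iterates of [g] ends at [g z]. For [j = k] the walk starts at [z] itself and
   contradicts the defeat of [z] by [g z]. *)
have path_z j : exists2 s, path (fun u v => w z <= margin P u v)
    (val (iter j g (g z))) s & last (val (iter j g (g z))) s = val (g z).
  elim: j => [|j [s path_s last_s]] /=; first by exists [::].
  exists (val (iter j g (g z)) :: s) => //=; rewrite path_s andbT.
  by apply: min_z; rewrite -iterSr.
have [s] := path_z k; rewrite -iterSr zk => path_s.
exact: (sc_no_path (scg z)).
Qed.

End SplitCycle.

(** * Constructions of profiles: new voters, restriction, relabelling, doubling, prescribed
    margins *)

Lemma fresh_seq (T : choiceType) (A : {fset T}) n : infinite_type T ->
  exists s : seq T, [/\ uniq s, size s = n & {in s, forall i, i \notin A}].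
Proof.
move=> infT; elim: n => [|n [s [Us szs sA]]]; first by exists [::].
have [i] := infT (s ++ A); rewrite mem_cat negb_or => /andP[is_ iA].
exists (i :: s); split; rewrite /= ?is_ ?szs // => j.
by rewrite inE => /orP[/eqP->//|/sA].
Qed.

(** List [V] twice, first with the elements satisfying [p] in front, then with those satisfying [q]
    in front; [sigma] matches equal positions. It supplies the voter permutations for anonymity. *)
Lemma count_matching (T : choiceType) (V : {fset T}) (p q : pred T) :
    count p V = count q V ->
  exists sigma : T -> T,
    [/\ {in V, forall i, sigma i \in V}, {in V &, injective sigma},
        {in V, forall j, exists2 i, i \in V & sigma i = j} &
        {in V, forall i, q (sigma i) = p i}].
Proof.
move=> pq; pose srt r := filter r V ++ filter (predC r) V.
have srtV r : perm_eq (srt r) V by rewrite perm_filterC.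
have Us r : uniq (srt r) by rewrite (perm_uniq (srtV r)) fset_uniq.
have mem_s r : srt r =i V by apply/perm_mem/srtV.
have sz_s r : size (srt r) = size V by apply/perm_size/srtV.
have lt_index r i : i \in V -> (index i (srt r) < size V)%N.
  by rewrite -(sz_s r) index_mem mem_s.
exists (fun i => nth i (srt q) (index i (srt p))); split.
- by move=> i iV; rewrite -(mem_s q) mem_nth // sz_s lt_index.
- move=> i j iV jV; rewrite (set_nth_default j) ?sz_s ?lt_index // => /eqP.
  rewrite nth_uniq ?sz_s ?lt_index // => /eqP eq_ij.
  by rewrite -(nth_index i (s := srt p) (x := i)) ?mem_s // eq_ij nth_index ?mem_s.
- move=> j jV; exists (nth j (srt p) (index j (srt q))).
    by rewrite -(mem_s p) mem_nth // sz_s lt_index.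
  rewrite index_uniq ?sz_s ?lt_index //.
  by rewrite (set_nth_default j) ?sz_s ?lt_index // nth_index ?mem_s.
move=> i iV; set k := index i _; have ltk : (k < size V)%N by rewrite lt_index.
have -> : p i = p (nth i (srt p) k) by rewrite nth_index ?mem_s.
(* The front blocks have the same length, so position [k] lies in both or in neither. *)
rewrite /srt !nth_cat !size_filter -pq; case: ltnP => lek.
  have /(mem_nth i) : (k < size (filter q V))%N by rewrite size_filter -pq.
  have /(mem_nth i) : (k < size (filter p V))%N by rewrite size_filter.
  by rewrite !mem_filter => /andP[-> _] /andP[-> _].
have szC r : count r V = count p V ->
    (k - count p V < size (filter (predC r) V))%N.
  by move=> rp; rewrite size_filter ltn_subLR // -rp count_predC.
have := mem_nth i (szC q (esym pq)); have := mem_nth i (szC p erefl).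
by rewrite !mem_filter => /andP[/negPf -> _] /andP[/negPf -> _].
Qed.

Section Constructions.
Variables Vt Xt : choiceType.
Implicit Types (P Q R Z : profile Vt Xt) (x y a b : Xt) (i j : Vt).
Implicit Types (X : {fset Xt}) (V A : {fset Vt}).

Lemma aboveC P i x y : i \in voters P -> x \in pcands P -> y \in pcands P ->
  x != y -> above P i y x = ~~ above P i x y.
Proof.
move=> iV xX yX xy; rewrite !aboveE // -leqNgt ltn_neqAle andb_idl // => _.
apply: contraNneq xy => eq_yx; apply/eqP.
rewrite -(nth_index x (s := ballot P i) (x := x)) ?mem_ballot // -eq_yx.
by rewrite nth_index // mem_ballot.
Qed.

(** Linear ballots have no ties, so in a given electorate the margin determines the number of
    supporters. *)
Lemma margin_count P x y : x \in pcands P -> y \in pcands P -> x != y ->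
  margin P x y =
    (count (fun i => above P i x y) (voters P))%:Z *+ 2 - (#|` voters P|)%:Z.
Proof.
move=> xX yX xy; pose p i := above P i x y.
rewrite -(count_predC p (voters P)) /margin.
rewrite (eq_in_count (a1 := fun i => above P i y x) (a2 := predC p)).
  by rewrite PoszD mulr2n opprD addrACA subrr add0r.
by move=> i iV; rewrite /= /p (aboveC iV xX yX xy).
Qed.

Lemma restrict_exists P X : X != fset0 -> X `<=` pcands P ->
  exists R, [/\ pcands R = X, voters R = voters P,
    {in X &, forall a b, margin R a b = margin P a b} &
    {in X &, forall x y, coh_step P R x y}].
Proof.
move=> X0 /fsubsetP XP.
have [||i iV|R [RX RV Rb]] := @profile_exists _ _ X (voters P)
  (fun i => filter (mem X) (ballot P i)).
- exact: X0.
- exact: voters_neq0.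
- apply: uniq_perm => [||a]; rewrite ?filter_uniq ?ballot_uniq ?fset_uniq //.
  by rewrite mem_filter mem_ballot //; apply/andb_idr/XP.
have ab : {in voters P, forall i, {in X &, forall a b, above P i a b = above R i a b}}.
  move=> i iV a b aX bX; rewrite !aboveE ?RX ?XP // Rb //.
  by rewrite index_filter_lt // mem_ballot ?XP.
have mE : {in X &, forall a b, margin R a b = margin P a b}.
  move=> a b aX bX; rewrite /margin RV.
  by congr (_%:Z - _%:Z); apply: eq_in_count => i iV; rewrite ab.
exists R; split=> // x y xX yX; split; rewrite ?RX //; first exact/fsubsetP.
  by move=> i iV; rewrite !ab.
by move=> a b aX bX _ _; rewrite mE.
Qed.

Lemma relabel_exists P (pi pi' : Xt -> Xt) : cancel pi pi' -> cancel pi' pi ->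
    {in pcands P, forall a, pi a \in pcands P} ->
    {in pcands P, forall a, pi' a \in pcands P} ->
  exists Q, [/\ pcands Q = pcands P, voters Q = voters P,
    {in voters P, forall i, {in pcands P &, forall a b,
      above P i a b = above Q i (pi a) (pi b)}},
    {in pcands P &, forall a b, margin P a b = margin Q (pi a) (pi b)} &
    forall f, neutrality f -> {in pcands P &, forall a b,
      f P a b <-> f Q (pi a) (pi b)}].
Proof.
move=> piK pi'K piX pi'X; have inj_pi := can_inj piK.
have [||i iV|Q [QX QV Qb]] := @profile_exists _ _ (pcands P) (voters P)
  (fun i => map pi (ballot P i)).
- exact: pcands_neq0.
- exact: voters_neq0.
- apply: uniq_perm => [||a]; rewrite ?map_inj_uniq ?ballot_uniq ?fset_uniq //.
  apply/mapP/idP => [[b bP ->]|aP]; first by rewrite piX // -(mem_ballot iV).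
  by exists (pi' a); rewrite ?pi'K // mem_ballot // pi'X.
have ab : {in voters P, forall i, {in pcands P &, forall a b,
    above P i a b = above Q i (pi a) (pi b)}}.
  by move=> i iV a b aX bX; rewrite !aboveE ?QX ?piX // Qb // !index_map.
exists Q; split=> // [a b aX bX|f neu a b aX bX].
  rewrite /margin QV.
  by congr (_%:Z - _%:Z); apply: eq_in_count => i iV; rewrite ab.
apply: neu => // [c d _ _|c cX]; first exact: inj_pi.
by exists (pi' c); rewrite ?pi'K ?pi'X.
Qed.

Lemma add_pair_exists P i j (s t : seq Xt) : i != j ->
    i \notin voters P -> j \notin voters P ->
    perm_eq s (pcands P) -> perm_eq t (pcands P) ->
  exists Q, [/\ pcands Q = pcands P, voters Q = i |` (j |` voters P),
    [/\ ballot Q i = s, ballot Q j = t &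
        {in voters P, forall k, ballot Q k = ballot P k}] &
    {in pcands P &, forall a b,
       margin Q a b = margin P a b + (bmargin s a b + bmargin t a b)}].
Proof.
move=> ij iP jP sX tX.
have [Q1 [[Q1X _ Q1V Q1b] Q1j Q1m]] := add_voter_exists jP tX.
have iQ1 : i \notin voters Q1 by rewrite Q1V !inE negb_or ij.
rewrite -Q1X in sX.
have [Q2 [[Q2X _ Q2V Q2b] Q2i Q2m]] := add_voter_exists iQ1 sX.
exists Q2; split; rewrite ?Q2X ?Q2V ?Q1V //.
  by split=> // [|k kP]; rewrite Q2b ?Q1V ?fset1U1 ?fset1Ur // Q1b.
by move=> a b aX bX; rewrite Q2m ?Q1X // Q1m // -addrA [bmargin t _ _ + _]addrC.
Qed.

(** The voters of [s] join two at a time, hence the parity condition. Their identities are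
    prescribed so that two electorates can be made equal. *)
Lemma add_reversals_exists P (s : seq Vt) : uniq s -> ~~ odd (size s) ->
    {in s, forall i, i \notin voters P} ->
  exists Q, [/\ pcands Q = pcands P, voters Q =i [predU s & voters P],
    forall a b, margin Q a b = margin P a b &
    forall f, neutral_reversal f -> forall x y, f P x y <-> f Q x y].
Proof.
have [n] := ubnP (size s); elim: n s => // n IHn [|i [|j s]] //= szs.
  by exists P; split=> // k; rewrite !inE.
rewrite inE negb_or negbK => /and3P[/andP[ij is_] js Us] ev sP.
have szs' : (size s < n)%N by lia.
have sP' : {in s, forall k, k \notin voters P}.
  by move=> k ks; apply: sP; rewrite !inE ks !orbT.
have [Q [QX QV Qm Qf]] := IHn s szs' Us ev sP'.
have [iP jP] : i \notin voters P /\ j \notin voters P.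
  by split; apply: sP; rewrite !inE eqxx ?orbT.
have iQ : i \notin voters Q by rewrite QV !inE negb_or is_.
have jQ : j \notin voters Q by rewrite QV !inE negb_or js.
have rvX : perm_eq (rev (pcands Q)) (pcands Q) by rewrite perm_rev.
have [Q' [Q'X Q'V [Q'i Q'j Q'b] _]] :=
  add_pair_exists ij iQ jQ (perm_refl (pcands Q)) rvX.
have rvQ : add_reversal_pair Q Q'.
  by split=> //; exists i, j; rewrite Q'i Q'j.
exists Q'; split=> [|k|a b|f nr x y]; rewrite ?Q'X //.
- by rewrite Q'V !inE QV !inE !orbA.
- by rewrite -(margin_reversal rvQ) Qm.
- by apply: (iff_trans (Qf f nr x y)); apply: nr.
Qed.

(** The [k]-th new voter copies the [k]-th old one. The even electorate can later be added to
    another profile in reversal pairs. *)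
Lemma doubling_exists P : infinite_type Vt ->
  exists Q, doubling P Q /\ ~~ odd #|` voters Q|.
Proof.
move=> infV; have [s [Us szs sP]] := fresh_seq (voters P) #|` voters P| infV.
pose phi j := if j \in s then nth j (voters P) (index j s) else j.
pose V := voters P `|` [fset j in s].
have permV : perm_eq V (voters P ++ s).
  apply: uniq_perm => [||j]; rewrite ?fset_uniq //.
    by rewrite cat_uniq fset_uniq Us andbT; apply/hasPn => j js; exact: sP.
  by rewrite mem_cat !inE.
have map_phi : map phi (voters P ++ s) = voters P ++ voters P.
  rewrite map_cat; congr (_ ++ _).
    rewrite -[RHS]map_id; apply/eq_in_map => j jV; rewrite /phi ifN //.
    by apply: contraL jV; exact: sP.
  have [k0 _] := fset0Pn _ (voters_neq0 P).
  apply: (@eq_from_nth _ k0) => [|k]; rewrite size_map // => ltk.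
  rewrite (nth_map k0) // /phi mem_nth // index_uniq //.
  by rewrite (set_nth_default k0) -?szs.
have phiV : {in V, forall j, phi j \in voters P}.
  move=> j; rewrite (perm_mem permV) => /(map_f phi).
  by rewrite map_phi mem_cat orbb.
have phi2 : {in voters P, forall i, count (fun j => phi j == i) V = 2%N}.
  move=> i iV; rewrite (permP permV) -(count_map phi (pred1 i)) map_phi.
  by rewrite count_cat count_uniq_mem ?fset_uniq // iV.
have V0 : V != fset0.
  by have [i iV] := fset0Pn _ (voters_neq0 P); apply/fset0Pn; exists i; rewrite inE iV.
have [|Q [QX QV Qb]] :=
  @profile_exists _ _ _ V (ballot P \o phi) (pcands_neq0 P) V0.
  by move=> j /phiV/ballot_perm.
exists Q; split; first by split=> //; exists phi; rewrite QV.
by rewrite QV (perm_size permV) size_cat szs addnn odd_double.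
Qed.

(* McGarvey's construction: the voters u > v > r and rev r > u > v add 2 to the
   margin of u over v and cancel out elsewhere. *)
Lemma mcgarvey X A (L : seq (Xt * Xt)) : infinite_type Vt -> X != fset0 ->
    {in L, forall e, [/\ e.1 \in X, e.2 \in X & e.1 != e.2]} ->
  exists Z, [/\ pcands Z = X, {in voters Z, forall i, i \notin A},
    ~~ odd #|` voters Z| &
    {in X &, forall a b, margin Z a b =
       ((count_mem (a, b) L)%:Z - (count_mem (b, a) L)%:Z) *+ 2}].
Proof.
move=> infV X0; elim: L => [_|[u v] L IHL LX].
  (* Electorates are nonempty, so the base case is one reversal pair, with all margins 0. *)
  have [[|i [|j [|? ?]]] [Us //= _ sA]] := fresh_seq A 2 infV.
  move: Us; rewrite /= inE andbT => ij.
  pose beta k := if k == i then X : seq Xt else rev X.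
  have V0 : [fset i; j] != fset0 by apply/fset0Pn; exists i; rewrite !inE eqxx.
  have [|Z [ZX ZV Zb]] := @profile_exists Vt Xt X [fset i; j] beta X0 V0.
    by move=> k _; rewrite /beta; case: ifP => // _; rewrite perm_rev.
  exists Z; split=> // [k|| a b aX bX].
  - by rewrite ZV !inE => kij; apply: sA; rewrite !inE.
  - by rewrite ZV cardfs2 ij.
  rewrite marginE ?ZX // ZV big_fsetU1 ?inE //= big_seq_fset1.
  rewrite !Zb ?inE ?eqxx ?orbT // /beta eqxx eq_sym (negPf ij).
  by rewrite bmargin_rev ?fset_uniq // subrr.
have [|Z [ZX ZA Zev Zm]] := IHL; first by move=> e eL; apply: LX; rewrite inE eL orbT.
have /LX[/= uX vX uv] : (u, v) \in (u, v) :: L by rewrite mem_head.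
have [[|i [|j [|? ?]]] [Us //= _ sA]] := fresh_seq (A `|` voters Z) 2 infV.
move: Us; rewrite /= inE andbT => ij.
have [/norP[iA iZ] /norP[jA jZ]] : ~~ ((i \in A) || (i \in voters Z)) /\
    ~~ ((j \in A) || (j \in voters Z)).
  by rewrite -!in_fsetU; split; apply: sA; rewrite !inE eqxx ?orbT.
pose r := filter (predC (pred2 u v)) X.
have permX : perm_eq (u :: v :: r) X.
  apply: uniq_perm => [||a]; rewrite ?fset_uniq //=.
    by rewrite !inE !mem_filter /= !eqxx orbT filter_uniq ?fset_uniq // (negPf uv).
  rewrite !inE mem_filter /=; have [->|_] //= := eqVneq a u.
  by have [->|] := eqVneq a v.
have permX' : perm_eq (rev (v :: u :: r)) X.
  by rewrite perm_rev; apply: perm_trans permX; rewrite (perm_catCA [:: v] [:: u]).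
rewrite -ZX in permX permX'.
have [Z' [Z'X Z'V _ Z'm]] := add_pair_exists ij iZ jZ permX permX'.
exists Z'; split; rewrite ?Z'X //.
- by move=> k; rewrite Z'V !inE => /or3P[/eqP->|/eqP->|/ZA].
- by rewrite Z'V !cardfsU1 !inE negb_or ij iZ jZ /= negbK.
move=> a b aX bX; rewrite Z'm ?ZX // Zm //.
have permX'' : perm_eq (v :: u :: r) X by rewrite -perm_rev -ZX.
rewrite bmargin_rev ?(perm_uniq permX'') ?(perm_mem permX'') ?fset_uniq //.
rewrite bmargin_top2 // -mulrnDl /= !xpair_eqE !PoszD.
by congr (_ *+ 2); rewrite opprD [RHS]addrACA [RHS]addrC.
Qed.

End Constructions.

(** * The two inclusions between [f] and Split Cycle *)

Section Uniqueness.
Variables (Vt Xt : choiceType) (f : VCCR_rel Vt Xt).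
Implicit Types (P Q R Z : profile Vt Xt) (x y a b : Xt) (i j : Vt).

(** Each of the [k] new voters ranks [y] above [x], so positive involvement preserves the absence of
    a defeat. *)
Lemma add_copies P (s : seq Xt) x y k : infinite_type Vt ->
    positive_involvement_in_defeat f -> perm_eq s (pcands P) ->
    x \in pcands P -> y \in pcands P -> (index y s < index x s)%N ->
    ~ f P x y ->
  exists Q, [/\ pcands Q = pcands P, ~ f Q x y &
    {in pcands P &, forall a b,
      margin Q a b = margin P a b + bmargin s a b *+ k}].
Proof.
move=> infV pid sX xX yX lt_yx Nf; elim: k => [|k [Q [QX Nf' Qm]]].
  by exists P; split=> // a b _ _; rewrite mulr0n addr0.
have [i iQ] := infV (voters Q); rewrite -QX in sX.
have [Q' [addQ' Q'i Q'm]] := add_voter_exists iQ sX.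
have [Q'X _ _ _] := addQ'.
exists Q'; split=> [||a b aX bX]; first by rewrite Q'X.
  by apply: (pid _ _ _ _ _ Nf' addQ'); rewrite aboveE ?Q'X ?QX ?Q'i.
by rewrite Q'm ?QX // Qm // mulrSr [RHS]addrA.
Qed.

Lemma sc_sub P x y : infinite_type Vt -> coherent_defeat f ->
  positive_involvement_in_defeat f -> sc P x y -> f P x y.
Proof.
move=> infV cd pid scP; apply: contrapT => Nf.
have m0 : 0 < margin P x y by case: scP.
have /andP[xX yX] := margin_cands m0.
have yx : y != x by apply: contraTneq m0 => ->; rewrite /margin subrr ltxx.
pose e u v := margin P x y <= margin P u v.
(* [S] is closed under edges of margin at least that of [x] over [y]; it contains [y] and, by the
   defeat, misses [x]. *)
pose S z := `[< exists2 s, path e y s & last y s = z >].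
have Sy : S y by apply/asboolP; exists [::].
have Sx : ~~ S x by apply/asboolP => -[s /(sc_no_path scP)].
have Sstep u v : S u -> ~~ S v -> margin P u v < margin P x y.
  move=> /asboolP[s path_s last_s]; apply: contraNT; rewrite -leNgt => euv.
  by apply/asboolP; exists (rcons s v); rewrite ?last_rcons // rcons_path path_s last_s.
pose X := pcands P.
(* Every candidate outside S is ranked above every candidate of S, except that
   y is above x. *)
pose top := filter (fun z => ~~ S z && (z != x)) X.
pose s := top ++ y :: x :: filter (fun z => S z && (z != y)) X.
have xtop : x \notin top by rewrite mem_filter eqxx andbF.
have Stop z : S z -> z \notin top by rewrite mem_filter => ->.
have sX : perm_eq s X.
  apply: uniq_perm => [||z]; rewrite ?fset_uniq //.
    rewrite cat_uniq filter_uniq ?fset_uniq //= !inE (negPf yx) /=.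
    rewrite !mem_filter eqxx (negPf Sx) !andbF filter_uniq ?fset_uniq //= andbT.
    rewrite Sy eqxx !andbF /= andbT; apply/hasPn => z.
    by rewrite mem_filter => /andP[/andP[Sz _] _]; apply: Stop.
  rewrite mem_cat !inE !mem_filter.
  have [->|zy] := eqVneq z y; first by rewrite orbT yX.
  by have [->|zx] := eqVneq z x; rewrite ?orbT ?xX // !andbT -andb_orl orNb.
have lt_yx : (index y s < index x s)%N.
  by rewrite !index_cat (negPf xtop) (negPf (Stop y Sy)) ltn_add2l /= !eqxx (negPf yx).
have below u v : v \in X -> S u -> ~~ S v -> (u, v) != (y, x) ->
    bmargin s u v = -1.
  move=> vX Su Sv uv; rewrite bmarginC bmargin1 // !index_cat.
  rewrite (negPf (Stop u Su)) mem_filter Sv vX andbT /=.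
  have [vx|vx] /= := eqVneq v x; last first.
    by apply: ltn_addr; rewrite index_mem mem_filter Sv vx.
  have uy : u != y by apply: contraNneq uv => ->; rewrite vx.
  rewrite vx ltn_add2l (negPf yx) ![_ == u]eq_sym (negPf uy).
  by case: (eqVneq u x) => // ux; rewrite ux (negPf Sx) in Su.
(* With [n] one less than the margin, [n] copies of [s] leave [x] a margin of 1 over [y] and make
   every edge out of [S] nonpositive. *)
have [n mn] : exists n, margin P x y = n.+1.
  by case: (margin P x y) m0 => [[|n]|n] // _; exists n.
have [Q [QX NfQ Qm]] := add_copies n infV pid sX xX yX lt_yx Nf.
have Qxy : margin Q x y = 1.
  by rewrite Qm // bmarginC bmargin1 // mn mulNrn; lia.
apply: NfQ; apply: cd => [|[t [/andP[_ path_t] last_t]]]; first by rewrite Qxy.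
move/negP: Sx; apply; rewrite -last_t.
(* A majority path of [Q] that starts in [S] stays in [S], so it cannot reach [x]. *)
suff reach : forall u, S u -> path (fun u v => 0 < margin Q u v) u t -> S (last u t).
  exact: reach.
elim: t {path_t last_t} => //= v t IHt u Su /andP[muv path_t].
apply: IHt path_t; apply: contraTT muv => Sv; rewrite -leNgt.
have [/andP[uX vX]|out] := boolP ((u \in pcands Q) && (v \in pcands Q)); last first.
  by rewrite margin_notin.
have [[-> ->]|uv] := eqVneq (u, v) (y, x); first by rewrite marginC Qxy.
rewrite QX in uX vX; rewrite Qm // below // mulNrn.
by have := Sstep u v Su Sv; rewrite mn; lia.
Qed.

Lemma ballot_two P x y i : pcands P = [fset x; y] -> x != y ->
  i \in voters P -> ballot P i = if above P i x y then [:: x; y] else [:: y; x].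
Proof.
move=> PX xy iV; have := ballot_uniq iV; have := mem_ballot iV.
have [xX yX] : x \in pcands P /\ y \in pcands P.
  by rewrite PX !inE !eqxx orbT.
have := perm_size (ballot_perm iV); rewrite aboveE // -/(#|` pcands P|) PX cardfs2 xy.
case: (ballot P i) => [|u [|v [|? ?]]] //= _ mem_b; rewrite inE andbT.
have := mem_b u; have := mem_b v; rewrite !inE !eqxx ?orbT /=.
have yx : (y == x) = false by rewrite eq_sym (negPf xy).
case/esym/orP => /eqP-> /esym/orP[] /eqP->; rewrite ?eqxx //=.
  by rewrite ?yx ?(negPf xy) ?eqxx ?yx ?(negPf xy).
Qed.

(** Moving [x] to the top of a single ballot removes exactly one supporter of [y], so every smaller
    count is reached. *)
Lemma raise_defeater P x y k : monotonicity_two f ->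
    pcands P = [fset x; y] -> x != y -> f P x y ->
    (k <= count (fun i => above P i y x) (voters P))%N ->
  exists Q, [/\ pcands Q = pcands P, voters Q = voters P, f Q x y &
    count (fun i => above Q i y x) (voters P) =
      (count (fun i => above P i y x) (voters P) - k)%N].
Proof.
move=> mono PX xy fP; elim: k => [|k IHk] lek; first by exists P; rewrite subn0.
have [Q [QX QV fQ cQ]] := IHk (ltnW lek).
have /hasP[i iV yx_i] : has (fun i => above Q i y x) (voters P).
  by rewrite has_count cQ; lia.
have iQ : i \in voters Q by rewrite QV.
pose beta j := if j == i then [:: x; y] else ballot Q j.
have [|Q' [Q'X Q'V Q'b]] :=
  @profile_exists _ _ _ _ beta (pcands_neq0 P) (voters_neq0 P).
  move=> j jV; rewrite /beta; case: eqP => _; last by rewrite -QX ballot_perm ?QV.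
  by rewrite PX; apply: uniq_perm => [||z]; rewrite ?fset_uniq ?inE //= ?inE ?xy.
have [xX yX] : x \in pcands P /\ y \in pcands P.
  by rewrite PX !inE !eqxx orbT.
exists Q'; split=> //.
  apply: (mono Q Q' x) fQ; first by rewrite QX PX cardfs2 xy.
  split; rewrite ?Q'V ?QV // Q'X QX; split=> //; exists i => //; split.
    exists [::], [::], y; rewrite Q'b // /beta eqxx (@ballot_two Q x y) ?QX //.
    by rewrite aboveC ?QX // in yx_i; rewrite (negPf yx_i).
  by move=> j jV ji; rewrite Q'b // /beta (negPf ji).
have V_rem := permP (perm_to_rem iV).
have Q'i : above Q' i y x = false.
  by rewrite aboveE ?Q'X // Q'b // /beta eqxx /= !eqxx (negPf xy).
rewrite subnS -cQ !V_rem /= Q'i yx_i /=; apply: eq_in_count => j.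
rewrite mem_rem_uniq ?fset_uniq // => /andP[/negPf ji jV].
by rewrite !aboveE ?Q'X ?QX // Q'b // /beta ji.
Qed.

Lemma defeat_margin_gt0 P x y : is_VCCR f -> anonymity f -> neutrality f ->
  monotonicity_two f -> coherent_IIA f -> f P x y -> 0 < margin P x y.
Proof.
move=> vccr anon neu mono cIIA fPxy.
have [xP yP NfPyx] := vccr _ _ _ fPxy.
have xy : x != y by apply: contra_notN NfPyx => /eqP eq_xy; move: fPxy; rewrite eq_xy.
rewrite ltNge; apply/negP => le_m.
have X0 : [fset x; y] != fset0 by apply/fset0Pn; exists x; rewrite !inE eqxx.
have XP : [fset x; y] `<=` pcands P.
  by apply/fsubsetP => z; rewrite !inE => /orP[]/eqP->.
have [R [RX RV Rm Rcoh]] := restrict_exists X0 XP.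
have [xX yX] : x \in pcands R /\ y \in pcands R.
  by rewrite RX !inE !eqxx orbT.
have fR : f R x y by apply: cIIA fPxy (Rcoh _ _ _ _); rewrite -RX.
pose nxy := count (fun i => above R i x y) (voters R).
pose nyx := count (fun i => above R i y x) (voters R).
have le_n : (nxy <= nyx)%N.
  by move: le_m; rewrite -Rm -?RX // /margin -/nxy -/nyx; lia.
(* Raise [x] until [y] has as many supporters in [Q] as [x] had in [R]. *)
have [|Q [QX QV fQ]] := @raise_defeater R x y (nyx - nxy) mono RX xy fR.
  exact: leq_subr.
rewrite -/nyx subKn // => cQ.
(* Exchanging [x] and [y] in [R] gives [S], where [y] defeats [x] and has the same number of
   supporters as in [Q]. *)
pose pi z := if z == x then y else if z == y then x else z.
have pix : pi x = y by rewrite /pi eqxx.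
have piy : pi y = x by rewrite /pi eqxx eq_sym (negPf xy).
have piK : involutive pi.
  move=> z; have [->|zx] := eqVneq z x; first by rewrite pix piy.
  have [->|zy] := eqVneq z y; first by rewrite piy pix.
  by rewrite /pi !(negPf zx, negPf zy).
have piX : {in pcands R, forall z, pi z \in pcands R}.
  by move=> z; rewrite RX !inE => /orP[]/eqP->; rewrite ?pix ?piy eqxx ?orbT.
have [S [SX SV Sab _ Sf]] := relabel_exists piK piK piX piX.
have fS : f S y x by rewrite -pix -{2}piy; apply/(Sf f neu).
have above_S i : i \in voters R -> above S i y x = above R i x y.
  by move=> iV; rewrite (Sab i iV) // pix piy.
(* [Q] and [S] then agree up to a permutation of voters, so both defeats hold in [Q], against
   asymmetry. *)
have [|sigma [sV inj_s sur_s sE]] := @count_matching _ (voters R)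
  (fun i => above Q i y x) (fun i => above S i y x).
  by rewrite cQ; apply: eq_in_count => i iV; rewrite above_S.
have yx : y != x by rewrite eq_sym.
have fQyx : f Q y x.
  apply/(anon S Q sigma) => //; rewrite ?SV ?QV // => i iV.
  rewrite !(@ballot_two _ y x) ?QV ?SV ?QX ?SX ?RX 1?fsetUC ?sE ?sV //.
by have [_ _] := vccr _ _ _ fQ.
Qed.

(* Reversal pairs bring both profiles to the same electorate without changing
   any margin; anonymity then aligns the ballots on x and y. *)
Lemma coherent_transfer P Z x y : anonymity f -> neutral_reversal f ->
    coherent_IIA f ->
    {in voters Z, forall i, i \notin voters P} ->
    ~~ odd #|` voters P| -> ~~ odd #|` voters Z| ->
    pcands Z `<=` pcands P -> x \in pcands Z -> y \in pcands Z -> x != y ->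
    margin Z x y = margin P x y ->
    {in pcands Z &, forall a b,
       ~ ((a == x) && (b == y) || (a == y) && (b == x)) ->
       0 < margin Z a b -> margin Z a b <= margin P a b} ->
  f P x y -> f Z x y.
Proof.
move=> anon nr cIIA disj evP evZ ZP xZ yZ xy eq_xy le_m fP.
(* Each profile receives the voters of the other. *)
have [P1 [P1X P1V P1m P1f]] := add_reversals_exists (fset_uniq (voters Z)) evZ disj.
have disj' : {in voters P, forall i, i \notin voters Z}.
  by move=> i iP; apply: contraL iP; apply: disj.
have [Z1 [Z1X Z1V Z1m Z1f]] := add_reversals_exists (fset_uniq (voters P)) evP disj'.
have V1 : voters P1 = voters Z1.
  by apply/fsetP => i; rewrite P1V Z1V !inE orbC.
have [xP yP] : x \in pcands P /\ y \in pcands P.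
  by split; apply: (fsubsetP ZP).
have eq_count : count (fun i => above P1 i x y) (voters P1) =
    count (fun i => above Z1 i x y) (voters P1).
  have := margin_count (P := P1) (x := x) (y := y).
  have := margin_count (P := Z1) (x := x) (y := y).
  by rewrite P1X Z1X P1m Z1m eq_xy -V1 => -> // /(_ xP yP xy); lia.
have [sigma [sV inj_s sur_s sE]] := count_matching eq_count.
(* [Z2] permutes the ballots of [Z1] so that every voter ranks [x] and [y] as in [P1]. *)
have [|Z2 [Z2X Z2V Z2b]] := @profile_exists _ _ _ _
  (ballot Z1 \o sigma) (pcands_neq0 Z) (voters_neq0 P1).
  by move=> i iV; rewrite -Z1X ballot_perm //= -V1 sV.
have Z2m a b : margin Z2 a b = margin Z a b.
  by rewrite -Z1m; apply/esym/(@margin_anonymity _ _ Z1 Z2 sigma); rewrite -?V1.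
apply/(Z1f f nr)/(anon Z1 Z2 sigma); rewrite -?V1 //.
apply: (cIIA P1) (proj1 (P1f f nr x y) fP) _.
have above2 i : i \in voters P1 -> above P1 i x y = above Z2 i x y.
  move=> iV; rewrite -sE // !aboveE ?Z2X ?Z1X //.
  by rewrite Z2b.
split; rewrite ?Z2X ?P1X //.
  by move=> i iV; split; rewrite ?(@aboveC _ _ _ i x y) ?Z2X ?P1X ?Z2V ?above2.
by move=> a b aZ bZ; rewrite Z2m P1m; apply: le_m.
Qed.

Lemma sub_sc P x y : infinite_type Vt -> is_VCCR f -> anonymity f ->
    neutrality f -> availability f -> upward_homogeneity f ->
    monotonicity_two f -> neutral_reversal f -> coherent_IIA f ->
  f P x y -> sc P x y.
Proof.
move=> infV vccr anon neu avail uhom mono nr cIIA fP.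
have m0 := defeat_margin_gt0 vccr anon neu mono cIIA fP.
apply: (no_path_sc m0) => t path_t last_t.
pose e u v := margin P x y <= margin P u v.
have path_e : path e y t by apply: sub_path path_t => u v /andP[].
(* A duplicate-free path from [y] to [x], closed by the edge [x -> y], makes [next] a permutation of
   the cycle. *)
move: last_t; case/shortenP: path_e => s path_s Us _ last_s {t path_t}.
pose c := y :: s; pose nx := next c.
have cyc : cycle e c by rewrite /= rcons_path path_s last_s /e lexx.
have e_nx z : z \in c -> e z (nx z) by apply: next_cycle.
have e_gt0 u v : e u v -> 0 < margin P u v by move=> uv; apply: lt_le_trans m0 uv.
have mem_nx z : (nx z \in c) = (z \in c) by rewrite mem_next.
have xc : x \in c by rewrite -last_s mem_last.
(* [x] is last in [c], so the lookup in [s] overruns and returns its default, the head [y]. *)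
have nx_x : nx x = y.
  have idx : index x c = size s by rewrite -last_s index_last.
  by rewrite /nx next_nth xc idx /c /= nth_default.
have cP z : z \in c -> z \in pcands P.
  by move=> /e_nx/e_gt0/margin_cands/andP[].
have [D [dD evD]] := doubling_exists P infV.
have DX : pcands D = pcands P by case: dD.
pose X := [fset z in c].
have inX z : (z \in X) = (z \in c) by rewrite !inE.
have XD : X `<=` pcands D by apply/fsubsetP => z; rewrite inX DX; apply: cP.
have X0 : X != fset0 by apply/fset0Pn; exists x; rewrite inX.
pose M := margin P x y *+ 2.
(* Equality is required only at the edge out of [z], where coherent IIA fixes the ballots; lower
   bounds suffice on the other edges. *)
pose inv z := exists R, [/\ pcands R = X, voters R = voters D,
  {in c, forall a, M <= margin R a (nx a)}, margin R z (nx z) = M &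
  f R z (nx z)].
have inv_x : inv x.
  have [R [RX RV Rm Rcoh]] := restrict_exists X0 XD.
  have Rm2 a b : a \in c -> b \in c -> margin R a b = margin P a b *+ 2.
    by move=> ac bc; rewrite Rm ?inX // (margin_doubling dD) ?cP.
  exists R; split=> // [a ac||].
  - by rewrite Rm2 ?mem_nx // lerMn2r /=; apply: e_nx.
  - by rewrite Rm2 ?mem_nx // nx_x.
  rewrite nx_x; apply: cIIA (uhom _ _ dD _ _ fP) (Rcoh _ _ _ _); rewrite inX //.
  by rewrite -nx_x mem_nx.
have inv_nx z : z \in c -> inv z -> inv (nx z).
  move=> zc [R [RX RV Rm Rz fR]].
  have nxX : {in pcands R, forall a, nx a \in pcands R}.
    by move=> a; rewrite RX !inX mem_nx.
  have pvX : {in pcands R, forall a, prev c a \in pcands R}.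
    by move=> a; rewrite RX !inX mem_prev.
  (* Relabelling by [nx] rotates the cycle: the defeat moves one edge on, and the bounds are
     permuted. *)
  have [Q [QX QV _ Qm Qf]] :=
    relabel_exists (prev_next Us) (next_prev Us) nxX pvX.
  have [zR nzR] : z \in pcands R /\ nx z \in pcands R.
    by rewrite RX !inX mem_nx.
  exists Q; split; rewrite ?QX ?QV -?Qm //; last exact/(Qf f neu).
  move=> a ac; have pac : prev c a \in c by rewrite mem_prev.
  by rewrite -(next_prev Us a) -Qm ?Rm // RX inX ?mem_nx.
have inv_c z : z \in c -> inv z.
  have : fpath nx y s by have := cycle_next Us; rewrite /= rcons_path => /andP[].
  case/fpathP => n sE.
  have -> : c = traject nx y n.+1 by rewrite /c sE.
  case/trajectP => i _ ->; elim: i => [|i IHi] /=.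
    by rewrite -nx_x; apply: inv_nx.
  apply: inv_nx IHi; elim: i => [|i IHi]; first exact: mem_head.
  by rewrite /= mem_nx.
have asym u v : e u v -> ~~ e v u.
  move=> /e_gt0; rewrite marginC oppr_gt0 => uv.
  by apply/negP => /e_gt0; rewrite ltNge ltW.
have nx_neq z : z \in c -> z != nx z.
  by move=> /e_nx ez; apply: contraTneq ez => <-; rewrite /e /margin subrr -ltNge.
(* The cycle has no two-edge loop, so opposite edges do not cancel in the McGarvey profile. *)
have nx2_neq z : z \in c -> z != nx (nx z).
  move=> zc; apply: contraTneq (asym _ _ (e_nx z zc)) => zE.
  by rewrite negbK {2}zE e_nx ?mem_nx.
have [k mk] : exists k, margin P x y = k%:Z.
  by case: (margin P x y) m0 => // k _; exists k.
pose E := [seq (a, nx a) | a <- c].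
have countE a b : count_mem (a, b) E = (a \in c) && (b == nx a).
  rewrite /E count_map; have [->|ba] := eqVneq b (nx a).
    rewrite andbT -(count_uniq_mem a Us); apply: eq_count => d /=.
    by rewrite xpair_eqE; apply: andb_idr => /eqP->.
  rewrite andbF (eq_count (a2 := pred0)) ?count_pred0 // => d /=.
  rewrite xpair_eqE; apply/andP => -[/eqP-> /eqP bE].
  by rewrite bE eqxx in ba.
(* Each occurrence of an edge adds 2 to its margin, so [k] copies of the cycle give [M]. *)
pose L := flatten (nseq k E).
have countL a b : count_mem (a, b) L = (((a \in c) && (b == nx a)) * k)%N.
  by rewrite count_flatten map_nseq sumn_nseq countE.
have LX : {in L, forall p, [/\ p.1 \in X, p.2 \in X & p.1 != p.2]}.
  move=> p /flattenP[E']; rewrite mem_nseq => /andP[_ /eqP->] /mapP[a ac ->] /=.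
  by rewrite !inX mem_nx; split=> //; apply: nx_neq.
have [Z [ZX ZD evZ Zm]] := mcgarvey (voters D) infV X0 LX.
have fZ z : z \in c -> f Z z (nx z).
  move=> zc; have [R [RX RV Rm Rz fR]] := inv_c z zc.
  apply: (coherent_transfer anon nr cIIA) fR; rewrite ?RV ?RX ?ZX ?inX ?mem_nx //.
  - exact: nx_neq.
  - rewrite Zm ?inX ?mem_nx // !countL !mem_nx zc eqxx (negPf (nx2_neq z zc)) /=.
    by rewrite Rz /M mk mul1n mul0n subr0.
  move=> a b aX bX _; rewrite Zm // !countL.
  (* Off the cycle edges the margins of [Z] are nonpositive; on them they are at most [M]. *)
  have [/andP[ac /eqP->] _|_] := boolP ((a \in c) && (b == nx a)).
    apply: le_trans (Rm a ac); rewrite /M mk lerMn2r /= mul1n gerBl.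
    by case: (_ && _).
  by rewrite mul0n sub0r mulNrn oppr_gt0 ltNge mulrn_wge0.
(* An undefeated [w] would lie on the cycle and be defeated by its predecessor. *)
have [w wZ Nw] := avail Z; have wc : w \in c by rewrite -inX -ZX.
have pwc : prev c w \in c by rewrite mem_prev.
apply: (Nw (prev c w)); first by rewrite ZX inX.
by rewrite -{2}(next_prev Us w); apply: fZ.
Qed.

End Uniqueness.

Theorem theorem4p1 (Vt Xt : choiceType)
    (HV : infinite_type Vt) (HX : infinite_type Xt) :
  (is_VCCR (@sc Vt Xt) /\ anonymity (@sc Vt Xt) /\ neutrality (@sc Vt Xt) /\
   availability (@sc Vt Xt) /\ homogeneity (@sc Vt Xt) /\
   monotonicity (@sc Vt Xt) /\ neutral_reversal (@sc Vt Xt) /\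
   coherent_IIA (@sc Vt Xt) /\ coherent_defeat (@sc Vt Xt) /\
   positive_involvement_in_defeat (@sc Vt Xt)) /\
  (forall f : VCCR_rel Vt Xt,
     is_VCCR f -> anonymity f -> neutrality f -> availability f ->
     upward_homogeneity f -> monotonicity_two f -> neutral_reversal f ->
     coherent_IIA f -> coherent_defeat f -> positive_involvement_in_defeat f ->
     forall (P : profile Vt Xt) (x y : Xt), f P x y <-> sc P x y).
Proof.
split.
  split; first exact: sc_VCCR.
  split; first exact: sc_anonymity.
  split; first exact: sc_neutrality.
  split; first exact: sc_availability.
  split; first exact: sc_homogeneity.
  split; first exact: sc_monotonicity.
  split; first exact: sc_neutral_reversal.
  split; first exact: sc_coherent_IIA.
  split; first exact: sc_coherent_defeat.
  exact: sc_positive_involvement.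
move=> f vccr anon neu avail uhom mono nr cIIA cd pid P x y; split.
  exact: sub_sc.
exact: sc_sub.
Qed.
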